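(* Let $n\ge0$, $k\ge1$ and $m\ge3$ be integers. The area of the $m$-sided polygon with vertices, in order, $V_i=(F_{n+2ik},F_{n+(2i+1)k})$ for $i=0,1,\dots,m-1$ equals $$\frac12\left|(m-1)F_kF_{2k}-F_kF_{(2m-2)k}\right|.$$ The area of the $m$-sided polygon with vertices, in order, $W_i=(L_{n+2ik},L_{n+(2i+1)k})$ for $i=0,1,\dots,m-1$ equals $$\frac52\left|(m-1)F_kF_{2k}-F_kF_{(2m-2)k}\right|.$$
   Context: $F_n$ denotes the Fibonacci numbers ($F_0=0$, $F_1=1$, $F_{n+1}=F_n+F_{n-1}$) and $L_n$ the Lucas numbers ($L_0=2$, $L_1=1$, $L_{n+1}=L_n+L_{n-1}$). The area of a polygon with vertices $(x_1,y_1),\dots,(x_m,y_m)$ taken in this order is given by the shoelace formula $\frac12\left|\sum_{i=1}^{m}(x_iy_{i+1}-x_{i+1}y_i)\right|$, indices taken mod $m$. *)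

(* Defs.v *)
From HB Require Import structures.
From mathcomp Require Import all_boot all_order all_algebra.

Set Implicit Arguments.
Unset Strict Implicit.
Unset Printing Implicit Defensive.

Import Order.TTheory GRing.Theory Num.Theory.

Local Open Scope ring_scope.

Fixpoint fib (n : nat) : nat :=
  match n with
  | 0 => 0
  | 1 => 1
  | (n2.+1 as n1).+1 => fib n1 + fib n2
  end%N.

Fixpoint lucas (n : nat) : nat :=
  match n with
  | 0 => 2
  | 1 => 1
  | (n2.+1 as n1).+1 => lucas n1 + lucas n2
  end%N.

(* Shoelace formula; [ordS] is the cyclic successor i |-> i + 1 mod m. *)
Definition polygon_area (R : realFieldType) (m : nat) (V : 'I_m -> R * R) : R :=
  2^-1 * `|\sum_(i < m) ((V i).1 * (V (ordS i)).2 - (V (ordS i)).1 * (V i).2)|.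

(* Main.v *)
(* For a sequence G with the Fibonacci recurrence, Vajda's identity
   G(a+p) G(a+q) - G(a) G(a+p+q) = (-1)^a (G(1)^2 - G(0) G(2)) F(p) F(q)
   evaluates every term of the shoelace sum. With a = n + 2ik, p = k, q = 2k, the
   sign is (-1)^n for every edge, so the first m-1 terms are equal; the closing
   edge is the case a = n, p = k, q = (2m-2)k, of opposite orientation. The
   characteristic G(1)^2 - G(0) G(2) is 1 for Fibonacci and -5 for Lucas numbers. *)
Require Import Defs.
From HB Require Import structures.
From mathcomp Require Import all_boot all_order all_algebra.
From mathcomp Require Import zify ring.

Set Implicit Arguments.
Unset Strict Implicit.
Unset Printing Implicit Defensive.

Import Order.TTheory GRing.Theory Num.Theory.

Local Open Scope ring_scope.

Lemma fibSS n : fib n.+2 = (fib n.+1 + fib n)%N.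
Proof. by []. Qed.

Lemma lucasSS n : lucas n.+2 = (lucas n.+1 + lucas n)%N.
Proof. by []. Qed.

Section FibonacciRecurrence.

Variables (R : comPzRingType) (G : nat -> R).
Hypothesis GSS : forall n, G n.+2 = G n.+1 + G n.

Definition characteristic : R := G 1%N ^+ 2 - G 0%N * G 2%N.

(** By the recurrence, the left side changes sign when [a] becomes [a.+1]. *)
Lemma cassini a : G a.+1 ^+ 2 - G a * G a.+2 = (-1) ^+ a * characteristic.
Proof.
elim: a => [|a IHa]; first by rewrite mul1r.
by rewrite (exprS (-1)) -mulrA -IHa !GSS; ring.
Qed.

(** For fixed [a] both sides obey the Fibonacci recurrence in [q], so two initial values suffice:
    [q = 0] is trivial and [q = 1] is [cassini]. *)
Lemma docagne a q :
  G a.+1 * G (a + q)%N - G a * G (a + q).+1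
    = (-1) ^+ a * characteristic * (fib q)%:R.
Proof.
elim/ltn_ind: q => -[|[|q]] IHq.
- by rewrite addn0 mulr0 mulrC subrr.
- by rewrite addn1 mulr1 -cassini expr2.
have := IHq q.+1 (ltnSn _); have := IHq q (ltnW (ltnSn _)).
rewrite fibSS natrD (mulrDr _ (fib _)%:R) => <- <-.
by rewrite !addnS !GSS; ring.
Qed.

(** The same two-step induction, now in [p]: the case [p = 1] is [docagne]. *)
Lemma vajda a p q :
  G (a + p)%N * G (a + q)%N - G a * G (a + p + q)%N
    = (-1) ^+ a * characteristic * (fib p)%:R * (fib q)%:R.
Proof.
elim/ltn_ind: p => -[|[|p]] IHp.
- by rewrite addn0 mulr0 mul0r subrr.
- by rewrite addn1 mulr1 addSn docagne.
have := IHp p.+1 (ltnSn _); have := IHp p (ltnW (ltnSn _)).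
rewrite fibSS natrD (mulrDr _ (fib _)%:R) (mulrDl _ _ (fib q)%:R) => <- <-.
by rewrite !addnS !addSn !GSS; ring.
Qed.

End FibonacciRecurrence.

(** Treats both polygons at once: they differ only in the factor [characteristic G]. *)
Lemma polygon_area_recurrence (R : realFieldType) (G : nat -> R) (n k m : nat)
    (GSS : forall j, G j.+2 = G j.+1 + G j) (hm : (0 < m)%N) :
  polygon_area (fun i : 'I_m =>
      (G (n + 2 * i * k)%N, G (n + (2 * i + 1) * k)%N))
    = `|characteristic G| / 2 *
      `|(m - 1)%:R * (fib k)%:R * (fib (2 * k))%:R
        - (fib k)%:R * (fib ((2 * m - 2) * k))%:R|.
Proof.
(* From here [m] is the number of vertices minus one. The closing edge is split off the sum; its end
   index [m.+1] reduces to 0. *)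
case: m hm => // m _; rewrite /polygon_area /= big_ord_recr /= modnn.
have edge (i : 'I_m) :
    G (n + 2 * i * k)%N * G (n + (2 * (i.+1 %% m.+1) + 1) * k)%N
      - G (n + 2 * (i.+1 %% m.+1) * k)%N * G (n + (2 * i + 1) * k)%N
    = - ((-1) ^+ n * characteristic G * (fib k)%:R * (fib (2 * k))%:R).
  (* Since [i < m], the successor index does not wrap around. *)
  rewrite modn_small ?ltnS //.
  have := vajda GSS (n + 2 * i * k) k (2 * k).
  rewrite exprD -mulnA (exprM _ 2) sqrrN !expr1n mulr1 => <-.
  have -> : (n + (2 * i.+1 + 1) * k = n + 2 * (i * k) + k + 2 * k)%N by lia.
  have -> : (n + 2 * i.+1 * k = n + 2 * (i * k) + 2 * k)%N by lia.
  have -> : (n + (2 * i + 1) * k = n + 2 * (i * k) + k)%N by lia.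
  by ring.
rewrite (eq_bigr _ (fun i _ => edge i)) sumr_const card_ord.
have := vajda GSS n k (2 * m * k).
have -> : (n + k + 2 * m * k = n + (2 * m + 1) * k)%N by lia.
have -> : (n + (2 * 0 + 1) * k = n + k)%N by lia.
have -> : (n + 2 * 0 * k = n)%N by lia.
have -> : ((2 * m.+1 - 2) * k = 2 * m * k)%N by lia.
rewrite [G (n + k)%N * _]mulrC => ->; rewrite subn1 /= -[_ *+ m]mulr_natr.
set f := (fib k)%:R; set g := (fib (2 * k))%:R; set h := (fib _)%:R.
have -> : - ((-1) ^+ n * characteristic G * f * g) * m%:R
    + (-1) ^+ n * characteristic G * f * h
    = (-1) ^+ n * (- (characteristic G * (m%:R * f * g - f * h))) by ring.
(* The sign [(-1) ^+ n], common to all edges, vanishes under the absolute value. *)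
by rewrite normrMsign normrN normrM mulrA [2^-1 * _]mulrC.
Qed.

Theorem theorem3p1 (R : realFieldType) (n k m : nat)
    (hk : (1 <= k)%N) (hm : (3 <= m)%N) :
  polygon_area (fun i : 'I_m =>
      ((fib (n + 2 * i * k))%:R, (fib (n + (2 * i + 1) * k))%:R) : R * R)
    = 1 / 2 * `|(m - 1)%:R * (fib k)%:R * (fib (2 * k))%:R
                - (fib k)%:R * (fib ((2 * m - 2) * k))%:R|
  /\
  polygon_area (fun i : 'I_m =>
      ((lucas (n + 2 * i * k))%:R, (lucas (n + (2 * i + 1) * k))%:R) : R * R)
    = 5 / 2 * `|(m - 1)%:R * (fib k)%:R * (fib (2 * k))%:R
                - (fib k)%:R * (fib ((2 * m - 2) * k))%:R|.
Proof.
have hm0 : (0 < m)%N by apply: leq_trans hm.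
split.
- rewrite (polygon_area_recurrence (G := fun j => (fib j)%:R)) //; last first.
    by move=> j; rewrite fibSS natrD.
  by rewrite /characteristic mul0r subr0 expr1n normr1.
- rewrite (polygon_area_recurrence (G := fun j => (lucas j)%:R)) //; last first.
    by move=> j; rewrite lucasSS natrD.
  have -> : characteristic (fun j => (lucas j)%:R) = - 5 :> R.
    by rewrite /characteristic /=; ring.
  by rewrite normrN normr_nat.
Qed.
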